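(* Let $(\mathcal{L},\circ_\lambda,[\cdot_\lambda\cdot])$ be a transposed Poisson conformal superalgebra (TPCSA). For any $h\in\mathcal{L}_{\bar0}$, define a linear map $\alpha_h:\mathcal{L}\to\mathcal{L}$ by $\alpha_h(x):=(h\circ_\lambda x)|_{\lambda=0}$ for all $x\in\mathcal{L}$. Then $(\mathcal{L},[\cdot_\lambda\cdot],\alpha_h)$ is a Hom-Lie conformal superalgebra.
   Context: All vector spaces and linear maps are over $\mathbb{C}$. A $\mathbb{Z}_2$-graded $\mathbb{C}[\partial]$-module is a $\mathbb{C}[\partial]$-module $A=A_{\bar0}\oplus A_{\bar1}$ with $\partial A_i\subseteq A_i$; $|a|$ denotes the parity of a homogeneous element $a$. Whenever $|a|$ occurs, $a$ is assumed homogeneous, and the formula is extended by linearity. $A[\lambda]$ denotes polynomials in $\lambda$ with coefficients in $A$. A conformal superalgebra $(A,\circ_\lambda)$ is a $\mathbb{Z}_2$-graded $\mathbb{C}[\partial]$-module $A$ with a $\mathbb{C}$-bilinear map $A\otimes A\to A[\lambda]$, $a\otimes b\mapsto a\circ_\lambda b$, with $A_i\circ_\lambda A_j\subseteq A_{i+j}[\lambda]$, satisfying sesquilinearity: $(\partial a)\circ_\lambda b=-\lambda\, a\circ_\lambda b$, $a\circ_\lambda(\partial b)=(\partial+\lambda)(a\circ_\lambda b)$. Substitution convention: if $a\circ_\lambda b=\sum_n\lambda^n c_n$, then $a\circ_{-\partial-\lambda}b=\sum_n(-\partial-\lambda)^nc_n$ with $\partial$ acting on the coefficients $c_n$, and similarly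 for brackets. It is commutative if $a\circ_\lambda b=(-1)^{|a||b|}b\circ_{-\partial-\lambda}a$, and associative if $a\circ_\lambda(b\circ_\mu c)=(a\circ_\lambda b)\circ_{\lambda+\mu}c$, for all $a,b,c$. A Lie conformal superalgebra $(A,[\cdot_\lambda\cdot])$ is a $\mathbb{Z}_2$-graded $\mathbb{C}[\partial]$-module with a $\mathbb{C}$-bilinear map $a\otimes b\mapsto[a_\lambda b]\in A[\lambda]$, $[{A_i}_\lambda A_j]\subseteq A_{i+j}[\lambda]$, such that (sesquilinearity) $[(\partial a)_\lambda b]=-\lambda[a_\lambda b]$, $[a_\lambda(\partial b)]=(\partial+\lambda)[a_\lambda b]$, (skew-symmetry) $[a_\lambda b]=-(-1)^{|a||b|}[b_{-\lambda-\partial}a]$, and (Jacobi) $[a_\lambda[b_\mu c]]=[[a_\lambda b]_{\lambda+\mu}c]+(-1)^{|a||b|}[b_\mu[a_\lambda c]]$. A transposed Poisson conformal superalgebra (TPCSA) is a $\mathbb{Z}_2$-graded $\mathbb{C}[\partial]$-module $\mathcal{L}$ with $\circ_\lambda$ and $[\cdot_\lambda\cdot]$ such that $(\mathcal{L},\circ_\lambda)$ is a commutative associative conformal superalgebra, $(\mathcal{L},[\cdot_\lambda\cdot])$ is a Lie conformal superalgebra, and $2(a\circ_\lambda[b_\mu c])=[(a\circ_\lambda b)_{\lambda+\mu}c]+(-1)^{|a||b|}[b_\mu(a\circ_\lambda c)]$ for all $a,b,c\in\mathcal{L}$. A Hom-Lie conformal superalgebra $(A,[\cdot_\lambda\cdot],\alpha)$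 is a $\mathbb{Z}_2$-graded $\mathbb{C}[\partial]$-module $A$ with an even linear endomorphism $\alpha$ satisfying $\alpha\partial=\partial\alpha$ and a $\mathbb{C}$-bilinear map $a\otimes b\mapsto[a_\lambda b]\in A[\lambda]$, $[{A_i}_\lambda A_j]\subseteq A_{i+j}[\lambda]$, satisfying sesquilinearity and skew-symmetry as in a Lie conformal superalgebra, and the Hom-Jacobi identity $[\alpha(a)_\lambda[b_\mu c]]=[[a_\lambda b]_{\lambda+\mu}\alpha(c)]+(-1)^{|a||b|}[\alpha(b)_\mu[a_\lambda c]]$. *)

(* Defs.v *)
From mathcomp Require Import all_boot all_order all_algebra.
From mathcomp Require Import finmap reals complex monalg.

Set Implicit Arguments.
Unset Strict Implicit.
Unset Printing Implicit Defensive.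

Import GRing.Theory.
Local Open Scope ring_scope.

(* For an abelian group V, {malg V[nat]} is V[λ] and poly2 V is
   V[λ, μ]: finitely supported families of coefficients p@_n (resp. p@_(n, m))
   in V.  << x *g k >> is the monomial of exponent k and coefficient x. *)

Notation poly2 V := {malg V[(nat * nat)%type]}.

Section Polynomials.
Variables (V : zmodType) (I : choiceType).

Definition mapcoef (f : V -> V) (p : {malg V[I]}) : {malg V[I]} :=
  \sum_(k <- msupp p) << f p@_k *g k >>.

Definition mapexp (s : I -> I) (p : {malg V[I]}) : {malg V[I]} :=
  \sum_(k <- msupp p) << p@_k *g s k >>.

(* If p = Σ_n λ^n c_n, then psubst T f p = Σ_n T^n (f c_n): the operator T is
   substituted for λ, the coefficients being first sent into W by f. *)
Definition psubst (W : zmodType) (T : W -> W) (f : V -> W)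
    (p : {malg V[nat]}) : W :=
  \sum_(n <- msupp p) iter n T (f p@_n).

End Polynomials.

Section Indeterminates.
Variable V : zmodType.

Definition mulX (p : {malg V[nat]}) : {malg V[nat]} := mapexp succn p.

Definition mulLam (p : poly2 V) : poly2 V :=
  mapexp (fun k => (k.1.+1, k.2)) p.
Definition mulMu (p : poly2 V) : poly2 V :=
  mapexp (fun k => (k.1, k.2.+1)) p.
Definition mulLamMu (p : poly2 V) : poly2 V :=
  mulLam p + mulMu p.

End Indeterminates.

Section ConformalSuperalgebras.
Variables (K : fieldType) (L : lmodType K).

(* A K[∂]-module is a K-vector space L with a linear endomorphism D, the action
   of ∂; gr i is the homogeneous component of parity i. *)
Variables (D : {linear L -> L}) (gr : 'Z_2 -> L -> Prop).

Definition ksign (i j : 'Z_2) : int := (-1) ^+ (i * j)%N.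

Record is_graded : Prop := {
  gr_zero : forall i, gr i 0;
  gr_add : forall i x y, gr i x -> gr i y -> gr i (x + y);
  gr_scale : forall i (c : K) x, gr i x -> gr i (c *: x);
  gr_der : forall i x, gr i x -> gr i (D x);
  gr_sum : forall x, exists x0 x1, [/\ gr 0 x0, gr 1 x1 & x = x0 + x1];
  gr_direct : forall x, gr 0 x -> gr 1 x -> x = 0
}.

Implicit Types (op : L -> L -> {malg L[nat]}) (alpha : L -> L).

Record is_conformal_product op : Prop := {
  cp_linl : forall (c : K) a a' b,
    op (c *: a + a') b = mapcoef ( *:%R c) (op a b) + op a' b;
  cp_linr : forall (c : K) a b b',
    op a (c *: b + b') = mapcoef ( *:%R c) (op a b) + op a b';
  cp_graded : forall i j a b, gr i a -> gr j b ->
    forall n, gr (i + j) (op a b)@_n;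
  cp_sesql : forall a b, op (D a) b = - mulX (op a b);
  cp_sesqr : forall a b, op a (D b) = mapcoef D (op a b) + mulX (op a b)
}.

(* a op_{-∂-λ} b *)
Definition op_swap op (a b : L) : {malg L[nat]} :=
  psubst (fun p => - mapcoef D p - mulX p) (fun x => << x *g 0%N >>) (op a b).

(* a op_T b in L[λ, μ], where T is multiplication by λ, μ or λ + μ *)
Definition op_at op (T : poly2 L -> poly2 L)
    (a b : L) : poly2 L :=
  psubst T (fun x => << x *g (0%N, 0%N) >>) (op a b).

(* a op1_S (b op2_T c) *)
Definition op_nestr op1 op2 S T (a b c : L) : poly2 L :=
  psubst T (fun x => op_at op1 S a x) (op2 b c).

(* (a op1_S b) op2_T c *)
Definition op_nestl op1 op2 S T (a b c : L) : poly2 L :=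
  psubst S (fun x => op_at op2 T x c) (op1 a b).

Definition op_commutative op : Prop :=
  forall i j a b, gr i a -> gr j b -> op a b = op_swap op b a *~ ksign i j.

Definition op_associative op : Prop :=
  forall a b c,
    op_nestr op op (@mulLam L) (@mulMu L) a b c
    = op_nestl op op (@mulLam L) (@mulLamMu L) a b c.

Definition op_skew op : Prop :=
  forall i j a b, gr i a -> gr j b -> op a b = - (op_swap op b a *~ ksign i j).

Definition op_hom_jacobi op alpha : Prop :=
  forall i j a b c, gr i a -> gr j b ->
    op_nestr op op (@mulLam L) (@mulMu L) (alpha a) b c
    = op_nestl op op (@mulLam L) (@mulLamMu L) a b (alpha c)
      + op_nestr op op (@mulMu L) (@mulLam L) (alpha b) a c *~ ksign i j.

Definition op_jacobi op : Prop :=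
  forall i j a b c, gr i a -> gr j b ->
    op_nestr op op (@mulLam L) (@mulMu L) a b c
    = op_nestl op op (@mulLam L) (@mulLamMu L) a b c
      + op_nestr op op (@mulMu L) (@mulLam L) b a c *~ ksign i j.

Definition transposed_leibniz circ br : Prop :=
  forall i j a b c, gr i a -> gr j b ->
    op_nestr circ br (@mulLam L) (@mulMu L) a b c *+ 2
    = op_nestl circ br (@mulLam L) (@mulLamMu L) a b c
      + op_nestr br circ (@mulMu L) (@mulLam L) b a c *~ ksign i j.

Record is_TPCSA circ br : Prop := {
  tp_graded : is_graded;
  tp_circ : is_conformal_product circ;
  tp_circC : op_commutative circ;
  tp_circA : op_associative circ;
  tp_br : is_conformal_product br;
  tp_skew : op_skew br;
  tp_jacobi : op_jacobi br;
  tp_leibniz : transposed_leibniz circ br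
}.

Record is_HomLie br alpha : Prop := {
  hl_graded : is_graded;
  hl_linear : linear alpha;
  hl_even : forall i x, gr i x -> gr i (alpha x);
  hl_der : forall x, alpha (D x) = D (alpha x);
  hl_br : is_conformal_product br;
  hl_skew : op_skew br;
  hl_jacobi : op_hom_jacobi br alpha
}.

(* (h op_λ x) at λ = 0 *)
Definition alpha_at op (h x : L) : L := psubst (fun=> 0) id (op h x).

End ConformalSuperalgebras.

(* Main.v *)
From HB Require Import structures.
Require Import Defs.
From mathcomp Require Import all_boot all_order all_algebra.
From mathcomp Require Import finmap reals complex monalg.

(** Setting [λ = 0] in the transposed Leibniz rule with first argument [h] gives
    [2 α_h [b_μ c] = [(α_h b)_μ c] + [b_μ (α_h c)]].  Any even additive map [α]
    satisfying this rule satisfies the Hom-Jacobi identity: if [J] is the Jacobi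
    identity at [(a, b, c)], then subtracting from [4 α(J)] the Jacobi
    identities at [(αa, b, c)], [(a, αb, c)] and [(a, b, αc)] leaves exactly the
    Hom-Jacobi identity at [(a, b, c)]. *)

Set Implicit Arguments.
Unset Strict Implicit.
Unset Printing Implicit Defensive.

Import GRing.Theory.
Local Open Scope ring_scope.

(** * Additive maps between abelian groups, as a predicate on bare functions *)

Section ZmodMorphisms.
Context {V W : zmodType}.
Implicit Types f g : V -> W.

Lemma zmod_morphism_sum f (fP : zmod_morphism f) (I : Type) (r : seq I)
    (F : I -> V) :
  f (\sum_(i <- r) F i) = \sum_(i <- r) f (F i).
Proof.
(* Packing [f] locally as an additive map makes the [raddf] lemmas available for a bare function. *)
pose fA : {additive V -> W} := HB.pack f (GRing.isZmodMorphism.Build V W f fP).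
exact: (raddf_sum fA).
Qed.

Lemma zmod_morphismMn f (fP : zmod_morphism f) n : {morph f : x / x *+ n}.
Proof.
pose fA : {additive V -> W} := HB.pack f (GRing.isZmodMorphism.Build V W f fP).
exact: (raddfMn fA).
Qed.

Lemma zmod_morphismMz f (fP : zmod_morphism f) n : {morph f : x / x *~ n}.
Proof.
pose fA : {additive V -> W} := HB.pack f (GRing.isZmodMorphism.Build V W f fP).
exact: (raddfMz fA).
Qed.

Lemma zmod_morphism0 f : zmod_morphism f -> f 0 = 0.
Proof. by move=> fP; rewrite -[X in f X](subrr 0) fP subrr. Qed.

Lemma zmod_morphismD f : zmod_morphism f -> {morph f : x y / x + y}.
Proof.
move=> fP x y; have fN z : f (- z) = - f z.
  by rewrite -[X in f X]sub0r fP (zmod_morphism0 fP) sub0r.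
by rewrite -[y in LHS]opprK fP fN opprK.
Qed.

Lemma zmod_morphism_add f g :
  zmod_morphism f -> zmod_morphism g -> zmod_morphism (fun x => f x + g x).
Proof. by move=> fP gP x y; rewrite fP gP opprD addrACA. Qed.

Lemma zmod_morphism_comp (U : zmodType) f (g : U -> V) :
  zmod_morphism f -> zmod_morphism g -> zmod_morphism (f \o g).
Proof. by move=> fP gP x y /=; rewrite gP fP. Qed.

Lemma zmod_morphism_null : zmod_morphism (fun _ : V => 0 : W).
Proof. by move=> x y; rewrite subrr. Qed.

End ZmodMorphisms.

Lemma zmod_morphism_iter (V : zmodType) (T : V -> V) n :
  zmod_morphism T -> zmod_morphism (iter n T).
Proof. by move=> TP; elim: n => [|n IH] x y //=; rewrite IH TP. Qed.

(** * Additive maps out of polynomials, determined on monomials *)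

Section LinearExtension.
Context {V W : zmodType} {I : choiceType}.

(** Common form of [mapcoef], [mapexp] and [psubst], each of which is convertible to an instance of
    it; additivity and values on monomials are then proved once. *)
Definition malgext (g : I -> V -> W) (p : {malg V[I]}) : W :=
  \sum_(k <- msupp p) g k p@_k.

Section Morphism.
Variable g : I -> V -> W.
Hypothesis gP : forall k, zmod_morphism (g k).

(** Indices outside the support contribute [g k 0 = 0]. This allows polynomials with different
    supports to be summed over one common index set. *)
Lemma malgextEw (d : {fset I}) (p : {malg V[I]}) :
  (msupp p `<=` d)%fset -> malgext g p = \sum_(k <- d) g k p@_k.
Proof.
move=> le; rewrite /malgext; apply: (big_fset_incl _ le) => k _.
by move/mcoeff_outdom->; rewrite (zmod_morphism0 (gP k)).
Qed.

Lemma malgextU x k : malgext g << x *g k >> = g k x.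
Proof. by rewrite (malgextEw msuppU_le) big_seq_fset1 mcoeffUU. Qed.

Lemma malgext_zmod_morphism : zmod_morphism (malgext g).
Proof.
move=> p q; pose d := (msupp p `|` msupp q)%fset.
rewrite (@malgextEw d (p - q)) ?msuppB_le //.
rewrite (@malgextEw d p) ?fsubsetUl // (@malgextEw d q) ?fsubsetUr //.
by rewrite -sumrB; apply: eq_bigr => k _; rewrite mcoeffB gP.
Qed.

End Morphism.

(** Every polynomial is a sum of monomials, so identities between additive operators need checking
    on monomials only. *)
Lemma zmod_morphism_malg_eq (F G : {malg V[I]} -> W) :
  zmod_morphism F -> zmod_morphism G ->
  (forall x k, F << x *g k >> = G << x *g k >>) -> F =1 G.
Proof.
move=> FP GP FG p; rewrite (monalgE p) !zmod_morphism_sum //.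
exact: eq_bigr.
Qed.

End LinearExtension.

Lemma mkmalgU_zmod_morphism (V : zmodType) (I : choiceType) (k : I) :
  zmod_morphism (fun x : V => << x *g k >>).
Proof. by move=> x y; rewrite monalgUB. Qed.

(** * Operations on coefficients and exponents, and substitution of an operator *)

Section Substitution.
Context {V : zmodType}.

Section Coefficients.
Context {I : choiceType}.

Lemma mapcoef_ext f : @mapcoef V I f =1 malgext (fun k x => << f x *g k >>).
Proof. by []. Qed.

Lemma mapexp_ext s : @mapexp V I s =1 malgext (fun k x => << x *g s k >>).
Proof. by []. Qed.

Lemma mapcoef_zmod_morphism f :
  zmod_morphism f -> zmod_morphism (@mapcoef V I f).
Proof.
move=> fP; apply: (malgext_zmod_morphism (g := fun k x => << f x *g k >>)).
by move=> k x y; rewrite fP monalgUB.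
Qed.

Lemma mapcoefU f x k : zmod_morphism f ->
  @mapcoef V I f << x *g k >> = << f x *g k >>.
Proof.
by move=> fP; rewrite mapcoef_ext malgextU // => l y z; rewrite fP monalgUB.
Qed.

Lemma mapexp_zmod_morphism s : zmod_morphism (@mapexp V I s).
Proof.
apply: (malgext_zmod_morphism (g := fun k x => << x *g s k >>)) => k.
exact: mkmalgU_zmod_morphism.
Qed.

Lemma mapexpU s x k : @mapexp V I s << x *g k >> = << x *g s k >>.
Proof.
by rewrite mapexp_ext malgextU // => l; apply: mkmalgU_zmod_morphism.
Qed.

Lemma mapcoef_mapexp f s p : zmod_morphism f ->
  @mapcoef V I f (mapexp s p) = mapexp s (mapcoef f p).
Proof.
move=> fP; move: p; apply: (zmod_morphism_malg_eq
  (F := mapcoef f \o mapexp s) (G := mapexp s \o mapcoef f)).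
- apply: zmod_morphism_comp; last exact: mapexp_zmod_morphism.
  exact: mapcoef_zmod_morphism.
- apply: zmod_morphism_comp; first exact: mapexp_zmod_morphism.
  exact: mapcoef_zmod_morphism.
by move=> x k /=; rewrite mapexpU !mapcoefU // mapexpU.
Qed.

End Coefficients.

Context {W : zmodType}.
Implicit Types (T : W -> W) (f : V -> W) (p : {malg V[nat]}).

Lemma psubst_ext T f : psubst T f =1 malgext (fun n x => iter n T (f x)).
Proof. by []. Qed.

Section Morphism.
Variables (T : W -> W) (f : V -> W).
Hypotheses (TP : zmod_morphism T) (fP : zmod_morphism f).

Lemma psubst_zmod_morphism : zmod_morphism (psubst T f).
Proof.
apply: (malgext_zmod_morphism (g := fun n x => iter n T (f x))) => n x y.
by rewrite fP (zmod_morphism_iter n TP).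
Qed.

Lemma psubstU x n : psubst T f << x *g n >> = iter n T (f x).
Proof.
rewrite psubst_ext malgextU // => m y z.
by rewrite fP (zmod_morphism_iter m TP).
Qed.

(** Multiplication by λ raises each exponent by one, which adds one iteration of [T]. *)
Lemma psubst_mulX p : psubst T f (mulX p) = T (psubst T f p).
Proof.
move: p; apply: (zmod_morphism_malg_eq
  (F := psubst T f \o @mulX V) (G := T \o psubst T f)).
- apply: zmod_morphism_comp; first exact: psubst_zmod_morphism.
  exact: mapexp_zmod_morphism.
- by apply: zmod_morphism_comp; last exact: psubst_zmod_morphism.
by move=> x n /=; rewrite /mulX mapexpU !psubstU.
Qed.

Lemma psubst_mapcoef (g : V -> V) p : zmod_morphism g ->
  psubst T f (mapcoef g p) = psubst T (f \o g) p.
Proof.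
move=> gP; rewrite /mapcoef zmod_morphism_sum; last exact: psubst_zmod_morphism.
by apply: eq_bigr => n _; rewrite psubstU.
Qed.

End Morphism.

Lemma psubstD T f g p : zmod_morphism T ->
  psubst T (fun x => f x + g x) p = psubst T f p + psubst T g p.
Proof.
move=> TP; rewrite -big_split; apply: eq_bigr => n _ /=.
by rewrite (zmod_morphismD (zmod_morphism_iter n TP)).
Qed.

Lemma eq_psubst T f g p : f =1 g -> psubst T f p = psubst T g p.
Proof. by move=> fg; apply: eq_bigr => n _; rewrite fg. Qed.

(** Since [phi] intertwines [T] and [T'], it passes through every iterate. It serves below with
    [phi] a scalar, ∂, evaluation at λ = 0, or α acting on coefficients. *)
Lemma zmod_morphism_psubst (W' : zmodType) (T' : W' -> W') T f
    (phi : W -> W') p :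
  zmod_morphism phi -> (forall w, phi (T w) = T' (phi w)) ->
  phi (psubst T f p) = psubst T' (phi \o f) p.
Proof.
move=> phiP phiT; rewrite zmod_morphism_sum //; apply: eq_bigr => n _ /=.
by elim: n (f _) => [|n IH] w //=; rewrite phiT IH.
Qed.

End Substitution.

Lemma psubst_mulX_id (V : zmodType) (p : {malg V[nat]}) :
  psubst (@mulX V) (fun x => << x *g 0%N >>) p = p.
Proof.
rewrite [RHS]monalgE; apply: eq_bigr => n _.
by elim: n p@_n => [|n IH] x //=; rewrite IH /mulX mapexpU.
Qed.

(** * Evaluation of V[λ, μ] at λ = 0 *)

Section AtLambda0.
Context {V : zmodType}.

(** The values land in the one-variable polynomials, so the surviving μ is renamed to the variable
    of [{malg V[nat]}]; [mulMu] and [mulLamMu] both become [mulX]. *)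
Definition lam0 : poly2 V -> {malg V[nat]} :=
  malgext (fun k x => if k.1 == 0%N then << x *g k.2 >> else 0).

Let lam0_subproof (k : nat * nat) :
  zmod_morphism (fun x : V => if k.1 == 0%N then << x *g k.2 >> else 0).
Proof. by move=> x y; case: ifP => _; rewrite ?monalgUB ?subrr. Qed.

Lemma lam0_zmod_morphism : zmod_morphism lam0.
Proof. exact: malgext_zmod_morphism. Qed.

Lemma lam0U x k : lam0 << x *g k >> = if k.1 == 0%N then << x *g k.2 >> else 0.
Proof. by rewrite /lam0 malgextU. Qed.

Lemma lam0_mulLam p : lam0 (mulLam p) = 0.
Proof.
move: p; apply: (zmod_morphism_malg_eq (F := lam0 \o @mulLam V) (G := fun=> 0)).
- apply: zmod_morphism_comp; first exact: lam0_zmod_morphism.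
  exact: mapexp_zmod_morphism.
- exact: zmod_morphism_null.
by move=> x k /=; rewrite /mulLam mapexpU lam0U.
Qed.

Lemma lam0_mulMu p : lam0 (mulMu p) = mulX (lam0 p).
Proof.
move: p; apply: (zmod_morphism_malg_eq
  (F := lam0 \o @mulMu V) (G := @mulX V \o lam0)).
- apply: zmod_morphism_comp; first exact: lam0_zmod_morphism.
  exact: mapexp_zmod_morphism.
- apply: zmod_morphism_comp; first exact: mapexp_zmod_morphism.
  exact: lam0_zmod_morphism.
move=> x k /=; rewrite /mulMu mapexpU !lam0U /=; case: ifP => _.
  by rewrite /mulX mapexpU.
by rewrite /mulX (zmod_morphism0 (mapexp_zmod_morphism _)).
Qed.

Lemma lam0_mulLamMu p : lam0 (mulLamMu p) = mulX (lam0 p).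
Proof.
by rewrite (zmod_morphismD lam0_zmod_morphism) lam0_mulLam lam0_mulMu add0r.
Qed.

End AtLambda0.

(** * Multiplication by λ, μ and λ + μ commutes with maps on coefficients *)

Section Indeterminates.
Context {V : zmodType}.

Lemma mulLam_zmod_morphism : zmod_morphism (@mulLam V).
Proof. exact: mapexp_zmod_morphism. Qed.

Lemma mulMu_zmod_morphism : zmod_morphism (@mulMu V).
Proof. exact: mapexp_zmod_morphism. Qed.

Lemma mulLamMu_zmod_morphism : zmod_morphism (@mulLamMu V).
Proof. by apply: zmod_morphism_add; apply: mapexp_zmod_morphism. Qed.

Variable f : V -> V.
Hypothesis fP : zmod_morphism f.

Lemma mapcoef_mulLam p : mapcoef f (mulLam p) = mulLam (mapcoef f p).
Proof. exact: mapcoef_mapexp. Qed.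

Lemma mapcoef_mulMu p : mapcoef f (mulMu p) = mulMu (mapcoef f p).
Proof. exact: mapcoef_mapexp. Qed.

Lemma mapcoef_mulLamMu p : mapcoef f (mulLamMu p) = mulLamMu (mapcoef f p).
Proof.
rewrite /mulLamMu (zmod_morphismD (mapcoef_zmod_morphism fP)).
by rewrite mapcoef_mulLam mapcoef_mulMu.
Qed.

End Indeterminates.

(** * Additivity of conformal products and first properties of α_h *)

Section ConformalProduct.
Context {K : fieldType} {L : lmodType K} {D : {linear L -> L}}.
Context {gr : 'Z_2 -> L -> Prop} {op : L -> L -> {malg L[nat]}}.
Hypothesis opP : is_conformal_product D gr op.

Lemma mapcoef_scaleN1 (p : {malg L[nat]}) : mapcoef ( *:%R (-1)) p = - p.
Proof.
rewrite [in RHS](monalgE p) -sumrN; apply: eq_bigr => n _.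
by rewrite scaleN1r monalgUN.
Qed.

Lemma cp_zmod_morphisml b : zmod_morphism (op^~ b).
Proof.
move=> a a'; rewrite addrC -scaleN1r (cp_linl opP) mapcoef_scaleN1.
by rewrite addrC.
Qed.

Lemma cp_zmod_morphismr a : zmod_morphism (op a).
Proof.
move=> b b'; rewrite addrC -scaleN1r (cp_linr opP) mapcoef_scaleN1.
by rewrite addrC.
Qed.

Section At.
Variable S : poly2 L -> poly2 L.
Hypothesis SP : zmod_morphism S.

Let at_psubst_zmod :
  zmod_morphism (psubst S (fun x : L => << x *g (0%N, 0%N) >>)).
Proof.
by apply: psubst_zmod_morphism; last exact: mkmalgU_zmod_morphism.
Qed.

Lemma op_at_zmod_morphisml b : zmod_morphism (fun a => op_at op S a b).
Proof. by move=> a a'; rewrite /op_at cp_zmod_morphisml at_psubst_zmod. Qed.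

Lemma op_at_zmod_morphismr a : zmod_morphism (op_at op S a).
Proof. by move=> b b'; rewrite /op_at cp_zmod_morphismr at_psubst_zmod. Qed.

(** At λ = 0 the operator [S] becomes multiplication by the remaining variable, and substituting
    that variable for itself returns the product unchanged. *)
Lemma lam0_op_at a b : (forall p, lam0 (S p) = mulX (lam0 p)) ->
  lam0 (op_at op S a b) = op a b.
Proof.
move=> S0; rewrite /op_at (zmod_morphism_psubst (T' := @mulX L)) //; last first.
  exact: lam0_zmod_morphism.
rewrite -[RHS]psubst_mulX_id; apply: eq_psubst => x /=.
by rewrite lam0U.
Qed.

End At.

Lemma alpha_at_linear h : linear (alpha_at op h).
Proof.
have idP : zmod_morphism (id : L -> L) by [].
move=> c x y; rewrite /alpha_at (cp_linr opP) zmod_morphismD; last first.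
  by apply: psubst_zmod_morphism => //; apply: zmod_morphism_null.
congr (_ + _); have cP : zmod_morphism ( *:%R c : L -> L).
  by move=> u v; rewrite scalerBr.
rewrite psubst_mapcoef //; last exact: zmod_morphism_null.
symmetry; apply: zmod_morphism_psubst => // w.
by rewrite scaler0.
Qed.

(** By sesquilinearity the product of h with ∂x is (∂ + λ) applied to the product of h with x; the λ
    term vanishes at λ = 0. *)
Lemma alpha_at_der h x : alpha_at op h (D x) = D (alpha_at op h x).
Proof.
have idP : zmod_morphism (id : L -> L) by [].
have DP : zmod_morphism D by move=> u v; rewrite raddfB.
rewrite /alpha_at (cp_sesqr opP) zmod_morphismD; last first.
  by apply: psubst_zmod_morphism => //; apply: zmod_morphism_null.
rewrite psubst_mulX //; last exact: zmod_morphism_null.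
rewrite addr0 psubst_mapcoef //; last exact: zmod_morphism_null.
symmetry; apply: zmod_morphism_psubst => // w.
by rewrite raddf0.
Qed.

Lemma alpha_at_graded h i j x : is_graded D gr -> gr i h -> gr j x ->
  gr (i + j) (alpha_at op h x).
Proof.
move=> grP ih jx; rewrite /alpha_at /psubst.
elim/big_ind: _ => [|u v|n _]; [exact: (gr_zero grP)|exact: (gr_add grP)|].
(* Only exponent 0 keeps its coefficient, its iterate being the identity; any positive iterate of
   the zero map is 0. *)
by case: n => [|n] /=; [apply: (cp_graded opP)|apply: (gr_zero grP)].
Qed.

End ConformalProduct.

(** Setting λ = 0 kills all but the constant term of [p]. With [p] the product of h and x, the inner
    product thus becomes α_h(x). *)
Lemma lam0_psubst_mulLam (V : zmodType) (f : V -> poly2 V) p :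
  zmod_morphism f ->
  lam0 (psubst (@mulLam V) f p) = lam0 (f (psubst (fun=> 0) id p)).
Proof.
move=> fP; have lfP : zmod_morphism (lam0 \o f).
  by apply: zmod_morphism_comp => //; apply: lam0_zmod_morphism.
rewrite (zmod_morphism_psubst (T' := fun=> 0)); last 2 first.
- exact: lam0_zmod_morphism.
- exact: lam0_mulLam.
symmetry; apply: (@zmod_morphism_psubst _ _ _ _ _ _ (lam0 \o f)) => // w.
exact: zmod_morphism0.
Qed.

(** The final cancellation, isolated in an abelian group. The first equation is 2α(J) with α moved
    one level in; u, v, w are the terms where α acts on an inner bracket, and doubling them moves α
    onto single elements. The equations for x, x2, x3 are the Jacobi identities with α on a, b, c.
    No division by 2 occurs. *)
Lemma half_derivation_cancel (V : zmodType)
    (x x2 x3 u y y1 y2 v z w w1 w3 : V) :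
  x + u = v + y + (z + w) -> u *+ 2 = x2 + x3 -> v *+ 2 = y1 + y2 ->
  w *+ 2 = w1 + w3 -> x = y1 + w1 -> x2 = y2 + z -> x3 = y + w3 -> x = y + z.
Proof.
rewrite (addrC z) => /(congr1 (fun t => t *+ 2)) E eu ev ew ex ex2 ex3; move: E.
rewrite !mulrnDl eu ev ew ex2 ex3 !mulr2n {2}ex.
rewrite -[_ + (y1 + w1) + _]addrA => E.
(* The added quantity is the sum of the right-hand sides of the three Jacobi identities. *)
apply: (addIr (y1 + w1 + (y2 + z + (y + w3)))).
by rewrite E [y1 + y2 + _ + _](AC (2*2*((1*1)*2))
  ((3*7)*((1*5)*((2*8)*(4*6))))).
Qed.

(** * Half-derivations of the bracket and the Hom-Jacobi identity *)

Section HalfDerivation.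
Context {K : fieldType} {L : lmodType K} {D : {linear L -> L}}.
Context {gr : 'Z_2 -> L -> Prop}.

(** This is a ½-derivation of the λ-bracket with the denominator cleared. *)
Definition half_derivation (br : L -> L -> {malg L[nat]}) (alpha : L -> L) :=
  forall b c, mapcoef alpha (br b c) *+ 2 = br (alpha b) c + br b (alpha c).

Lemma alpha_at_half_derivation (circ br : L -> L -> {malg L[nat]}) (h : L) :
  is_TPCSA D gr circ br -> gr 0 h -> half_derivation br (alpha_at circ h).
Proof.
move=> P gh b c; have circP := tp_circ P; have brP := tp_br P.
have homog j b' : gr j b' ->
    mapcoef (alpha_at circ h) (br b' c) *+ 2
    = br (alpha_at circ h b') c + br b' (alpha_at circ h c).
  move=> gb; have := tp_leibniz P c gh gb.
  (* As h is even, the sign in the Leibniz rule is trivial whatever the parity of the second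
     argument. *)
  have -> : ksign 0 j = 1 by rewrite /ksign mul0n expr0.
  rewrite mulr1z => /(congr1 lam0).
  rewrite (zmod_morphismMn lam0_zmod_morphism).
  rewrite (zmod_morphismD lam0_zmod_morphism).
  have LamP := @mulLam_zmod_morphism L; have MuP := @mulMu_zmod_morphism L.
  have LMP := @mulLamMu_zmod_morphism L.
  rewrite /op_nestl lam0_psubst_mulLam; last exact: (op_at_zmod_morphisml brP).
  rewrite (lam0_op_at (S := @mulLamMu L)); last exact: lam0_mulLamMu.
  rewrite /op_nestr [X in _ + X]lam0_psubst_mulLam; last first.
    exact: (op_at_zmod_morphismr brP).
  rewrite (lam0_op_at (S := @mulMu L)); last exact: lam0_mulMu.
  move=> <-; congr (_ *+ 2).
  rewrite (zmod_morphism_psubst (T' := @mulX L)); last 2 first.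
  - exact: lam0_zmod_morphism.
  - exact: lam0_mulMu.
  (* The left side is written as a substitution of the variable for itself, so that both sides are
     compared coefficient by coefficient. *)
  rewrite -[LHS]psubst_mulX_id psubst_mapcoef; last 3 first.
  - exact: mapexp_zmod_morphism.
  - exact: mkmalgU_zmod_morphism.
  - by move=> x y; rewrite /alpha_at (cp_zmod_morphismr circP)
      psubst_zmod_morphism //; apply: zmod_morphism_null.
  apply: eq_psubst => x /=; rewrite /op_at lam0_psubst_mulLam ?lam0U //.
  exact: mkmalgU_zmod_morphism.
have alphaD : {morph alpha_at circ h : x y / x + y}.
  by move=> x y; rewrite -[x]scale1r (alpha_at_linear circP) !scale1r.
(* The Leibniz rule covers homogeneous arguments only; additivity in b extends the result from the
   even and odd parts. *)
have [b0 [b1 [g0 g1 ->]]] := gr_sum (tp_graded P) b.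
rewrite alphaD !(zmod_morphismD (cp_zmod_morphisml brP _)).
rewrite zmod_morphismD; last first.
  apply: mapcoef_zmod_morphism => x y.
  by rewrite -scaleN1r addrC (alpha_at_linear circP) scaleN1r addrC.
by rewrite mulrnDl (homog _ _ g0) (homog _ _ g1) addrACA.
Qed.

Variables (br : L -> L -> {malg L[nat]}) (alpha : L -> L).
Hypotheses (brP : is_conformal_product D gr br) (alphaP : zmod_morphism alpha).
Hypothesis half : half_derivation br alpha.

Section Nested.
Variables S T : poly2 L -> poly2 L.
Hypotheses (SP : zmod_morphism S) (TP : zmod_morphism T).
Hypothesis alphaS : forall p, mapcoef alpha (S p) = S (mapcoef alpha p).
Hypothesis alphaT : forall p, mapcoef alpha (T p) = T (mapcoef alpha p).

Lemma half_derivation_op_at (T' : poly2 L -> poly2 L) b c :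
  zmod_morphism T' ->
  (forall p, mapcoef alpha (T' p) = T' (mapcoef alpha p)) ->
  mapcoef alpha (op_at br T' b c) *+ 2
  = op_at br T' (alpha b) c + op_at br T' b (alpha c).
Proof.
move=> TP' alphaT'.
have monP := @mkmalgU_zmod_morphism L _ (0%N, 0%N).
have psP := psubst_zmod_morphism TP' monP.
rewrite /op_at -(zmod_morphismD psP) -half (zmod_morphismMn psP).
congr (_ *+ 2); rewrite psubst_mapcoef //.
rewrite (zmod_morphism_psubst (T' := T')); [|exact: mapcoef_zmod_morphism|by []].
by apply: eq_psubst => x /=; rewrite mapcoefU.
Qed.

(** The rule is applied to the outer bracket only: α falls on a or on the whole inner bracket. The
    companion [half_derivation_nestr_inner] then splits the latter term. *)
Lemma half_derivation_nestr a b c :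
  mapcoef alpha (op_nestr br br S T a b c) *+ 2
  = op_nestr br br S T (alpha a) b c
    + psubst T (op_at br S a) (mapcoef alpha (br b c)).
Proof.
have atP d := op_at_zmod_morphismr brP SP d.
rewrite /op_nestr (zmod_morphism_psubst (T' := T)) //; last first.
  exact: mapcoef_zmod_morphism.
rewrite psubst_mapcoef // -psubstD // mulr2n -psubstD //.
by apply: eq_psubst => x /=; rewrite -mulr2n half_derivation_op_at.
Qed.

Lemma half_derivation_nestr_inner a b c :
  psubst T (op_at br S a) (mapcoef alpha (br b c)) *+ 2
  = op_nestr br br S T a (alpha b) c + op_nestr br br S T a b (alpha c).
Proof.
have psP := psubst_zmod_morphism TP (op_at_zmod_morphismr brP SP a).
by rewrite -(zmod_morphismMn psP) half (zmod_morphismD psP).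
Qed.

Lemma half_derivation_nestl a b c :
  mapcoef alpha (op_nestl br br S T a b c) *+ 2
  = psubst S (fun x => op_at br T x c) (mapcoef alpha (br a b))
    + op_nestl br br S T a b (alpha c).
Proof.
have atP d := op_at_zmod_morphisml brP TP d.
rewrite /op_nestl (zmod_morphism_psubst (T' := S)) //; last first.
  exact: mapcoef_zmod_morphism.
rewrite psubst_mapcoef // -psubstD // mulr2n -psubstD //.
by apply: eq_psubst => x /=; rewrite -mulr2n half_derivation_op_at.
Qed.

Lemma half_derivation_nestl_inner a b c :
  psubst S (fun x => op_at br T x c) (mapcoef alpha (br a b)) *+ 2
  = op_nestl br br S T (alpha a) b c + op_nestl br br S T a (alpha b) c.
Proof.
have psP := psubst_zmod_morphism SP (op_at_zmod_morphisml brP TP c).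
by rewrite -(zmod_morphismMn psP) half (zmod_morphismD psP).
Qed.

End Nested.

Lemma half_derivation_hom_jacobi :
  (forall i x, gr i x -> gr i (alpha x)) ->
  op_jacobi gr br -> op_hom_jacobi gr br alpha.
Proof.
move=> evenP jacP i j a b c ga gb.
have LamP := @mulLam_zmod_morphism L; have MuP := @mulMu_zmod_morphism L.
have LMP := @mulLamMu_zmod_morphism L.
have aLam := mapcoef_mulLam alphaP; have aMu := mapcoef_mulMu alphaP.
have aLM := mapcoef_mulLamMu alphaP.
(* Since α preserves parity, all three Jacobi identities carry the same sign [ksign i j]. *)
have j1 := jacP _ _ _ _ c (evenP _ _ ga) gb.
have j2 := jacP _ _ _ _ c ga (evenP _ _ gb).
have j3 := jacP _ _ _ _ (alpha c) ga gb.
have hR := half_derivation_nestr LamP MuP aLam aMu a b c.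
have hL := half_derivation_nestl LamP LMP aLam aLM a b c.
have hR' := half_derivation_nestr MuP LamP aMu aLam b a c.
have hRi := half_derivation_nestr_inner LamP MuP a b c.
have hLi := half_derivation_nestl_inner LamP LMP a b c.
have hRi' := half_derivation_nestr_inner MuP LamP b a c.
have mP : zmod_morphism (mapcoef alpha : poly2 L -> poly2 L).
  exact: mapcoef_zmod_morphism.
have j0 := congr1 (fun p => mapcoef alpha p *+ 2) (jacP _ _ _ _ c ga gb).
have sP : zmod_morphism (fun p : poly2 L => p *~ ksign i j).
  by move=> p q; rewrite mulrzBl.
(* The sign acts as an integer multiple, so it passes through the doubled identities for the last
   Jacobi term. *)
have sum_s (p q r : poly2 L) : p *+ 2 = q + r ->
    p *~ ksign i j *+ 2 = q *~ ksign i j + r *~ ksign i j.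
  by move=> pqr; rewrite -mulrzDl -pqr; exact: esym (zmod_morphismMn sP 2 p).
rewrite /= (zmod_morphismD mP) (zmod_morphismMz mP) mulrnDl in j0.
have {}j0 := etrans (esym hR) (etrans j0 (congr2 +%R hL (sum_s _ _ _ hR'))).
exact: half_derivation_cancel j0 hRi hLi (sum_s _ _ _ hRi') j1 j2 j3.
Qed.

End HalfDerivation.

Theorem proposition3p8 (R : realType) (L : lmodType R[i]) (D : {linear L -> L})
    (gr : 'Z_2 -> L -> Prop) (circ br : L -> L -> {malg L[nat]}) :
  is_TPCSA D gr circ br ->
  forall h : L, gr 0 h -> is_HomLie D gr br (alpha_at circ h).
Proof.
move=> P h gh; have circP := tp_circ P.
have even i x : gr i x -> gr i (alpha_at circ h x).
  (* The parity of h is 0, so α_h shifts degrees by 0. *)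
  by move/(alpha_at_graded circP (tp_graded P) gh); rewrite add0r.
split=> //.
- exact: (tp_graded P).
- exact: (alpha_at_linear circP h).
- exact: (alpha_at_der circP).
- exact: (tp_br P).
- exact: (tp_skew P).
apply: (half_derivation_hom_jacobi (tp_br P)) => //.
- by move=> x y; rewrite -scaleN1r addrC (alpha_at_linear circP) scaleN1r addrC.
- exact: (alpha_at_half_derivation P gh).
exact: (tp_jacobi P).
Qed.
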